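(* Let $G$ be a group and let $G_0$ be a subgroup of $G$. Suppose that, for each nonempty, finite subset $X$ of $G \setminus G_0$, there exists a proper subgroup of $\langle X\rangle$ that is left relatively convex in $\langle X\rangle$ and that includes $\langle X\rangle\cap G_0$. Then $G_0$ is left relatively convex in $G$.
   Context: An order on a set is a transitive, trichotomous binary relation $<$ (i.e. a strict total order: for all $x,y$ exactly one of $x<y$, $x=y$, $y<x$ holds). A subgroup $H$ of a group $K$ is left relatively convex in $K$ if the left $K$-set $K/H$ of left cosets admits at least one $K$-invariant order, i.e. an order $<$ such that $aH<bH$ implies $kaH<kbH$ for all $a,b,k\in K$. No left-orderability of $K$ is assumed. $\langle X\rangle$ denotes the subgroup generated by $X$. *)

(* Defs.v *)
From mathcomp Require Import all_boot all_classical.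

Set Implicit Arguments.
Unset Strict Implicit.
Unset Printing Implicit Defensive.

Local Open Scope classical_set_scope.
Local Open Scope group_scope.

(* Groups may be infinite, so a subgroup is a Prop-valued set; [group_closed]
   is the boolean-predicate notion, reached through classical membership. *)
Definition is_subgroup (G : groupType) (H : set G) : Prop :=
  group_closed (mem H).

Definition generated (G : groupType) (X : set G) : set G :=
  smallest (@is_subgroup G) X.

Definition left_coset (G : groupType) (H : set G) (a : G) : set G :=
  [set a * h | h in H].

Definition left_cosets (G : groupType) (K H : set G) : set (set G) :=
  [set left_coset H a | a in K].

(* Strict total order on the set [E]; the values of [lt] outside [E] are
   irrelevant. *)
Definition order_on (T : Type) (E : set T) (lt : T -> T -> Prop) : Prop :=
  (forall x y z, E x -> E y -> E z -> lt x y -> lt y z -> lt x z) /\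
  (forall x y, E x -> E y ->
     [\/ [/\ lt x y, x <> y & ~ lt y x],
         [/\ ~ lt x y, x = y & ~ lt y x] |
         [/\ ~ lt x y, x <> y & lt y x]]).

(* [K] and [H] are meant to be subgroups of the ambient [G] with [H] included
   in [K]; the elements of [K/H] are the left cosets [aH], [a] in [K]. *)
Definition left_relatively_convex (G : groupType) (K H : set G) : Prop :=
  exists lt : set G -> set G -> Prop,
    order_on (left_cosets K H) lt /\
    (forall a b k, K a -> K b -> K k ->
       lt (left_coset H a) (left_coset H b) ->
       lt (left_coset H (k * a)) (left_coset H (k * b))).

(* Main.v *)
Require Import Defs.
From mathcomp Require Import all_boot all_classical.

Set Implicit Arguments.
Unset Strict Implicit.
Unset Printing Implicit Defensive.

Local Open Scope classical_set_scope.
Local Open Scope group_scope.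

(** [G0] is relatively convex as soon as some subsemigroup [P] avoids [G0] and
    contains [x] or [x^-1] for every [x] outside [G0]: then [aG0 < bG0] iff
    [a^-1 b] lies in [P]. For finitely many [x] such a semigroup is found by
    induction on their number: the hypothesis gives a proper relatively convex
    subgroup [H], whose positive cone takes care of the [x] outside [H] and
    absorbs multiplication by elements of [H], while the [x] inside [H] are
    fewer. An ultrafilter on the finite lists then glues these semigroups. *)

Section Subgroups.
Variables (G : groupType) (H : set G).
Hypothesis subH : is_subgroup H.

Lemma subgroup1 : H 1.
Proof. by case: subH => /[1!inE]. Qed.

Lemma subgroupV x : H x -> H x^-1.
Proof. by move=> Hx; have := @group_closedV _ _ subH x; rewrite !inE; apply. Qed.

Lemma subgroupM x y : H x -> H y -> H (x * y).
Proof. by move=> Hx Hy; have := @group_closedM _ _ subH x y; rewrite !inE; apply. Qed.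

Lemma left_coset_eq a b : left_coset H a = left_coset H b <-> H (a^-1 * b).
Proof.
split=> [eq_ab | Hab].
  have : left_coset H b b by exists 1; [exact: subgroup1 | rewrite mulg1].
  by rewrite -eq_ab => -[h Hh <-]; rewrite mulKg.
apply/seteqP; split=> _ [h Hh <-].
  exists ((a^-1 * b)^-1 * h); first exact/subgroupM/Hh/subgroupV.
  by rewrite invgM invgK -!mulgA mulVKg.
by exists (a^-1 * b * h); [exact: subgroupM | rewrite -mulgA mulVKg].
Qed.

End Subgroups.

Lemma generated_subgroup (G : groupType) (X : set G) :
  is_subgroup (generated X).
Proof.
split=> [|x y]; rewrite !inE; first by move=> A [sA _]; apply: subgroup1 sA.
move=> gx gy A [sA XA].
have [Ax Ay] : A x /\ A y by split; [apply: gx | apply: gy].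
exact: (subgroupM sA Ax (subgroupV sA Ay)).
Qed.

(** The elements above the base coset [H]. When [H] is a subgroup, [P] cannot contain both [x] and
    [x^-1], since their product [1] lies in [H]. *)
Definition positive_cone (G : groupType) (K H P : set G) : Prop :=
  [/\ P `<=` K `\` H,
      forall x y, P x -> P y -> P (x * y) &
      forall x, K x -> ~ H x -> P x \/ P x^-1].

Section Cones.
Variables (G : groupType) (K H : set G).
Hypotheses (subK : is_subgroup K) (subH : is_subgroup H) (HK : H `<=` K).

(** Otherwise [(h * x)^-1] is in [P], and so is [x * (h * x)^-1 = h^-1], an element of [H]. *)
Lemma positive_coneMl P h x : positive_cone K H P -> H h -> P x -> P (h * x).
Proof.
move=> [PKH PM Ptot] Hh Px; have [Kx nHx] := PKH _ Px.
have [||//|Phx] := Ptot (h * x).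
- exact/(subgroupM subK)/Kx/HK.
- by move=> /(subgroupM subH (subgroupV subH Hh)); rewrite mulKg.
have [_ []] := PKH _ (PM _ _ Px Phx).
by rewrite invgM mulVKg; apply: subgroupV.
Qed.

(** Mirror argument: [(x * h)^-1 * x = h^-1] would be in [P]. *)
Lemma positive_coneMr P h x : positive_cone K H P -> H h -> P x -> P (x * h).
Proof.
move=> [PKH PM Ptot] Hh Px; have [Kx nHx] := PKH _ Px.
have [||//|Pxh] := Ptot (x * h).
- exact/(subgroupM subK Kx)/HK.
- by move=> /(subgroupM subH)/(_ (subgroupV subH Hh)); rewrite mulgK.
have [_ []] := PKH _ (PM _ _ Pxh Px).
by rewrite invgM mulgVK; apply: subgroupV.
Qed.

Lemma left_relatively_convex_cone :
  left_relatively_convex K H -> exists P, positive_cone K H P.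
Proof.
move=> [lt [[lt_trans lt_tri] lt_mul]].
have K1 := subgroup1 subK.
have cosetK a : K a -> left_cosets K H (left_coset H a) by exists a.
exists [set x | K x /\ lt (left_coset H 1) (left_coset H x)].
split=> [x [Kx lt1x]|x y [Kx lt1x] [Ky lt1y]|x Kx nHx].
- split=> // Hx; have eq1x : left_coset H 1 = left_coset H x.
    by apply/left_coset_eq => //; rewrite invg1 mul1g.
  by case: (lt_tri _ _ (cosetK _ K1) (cosetK _ Kx)) => [[]|[]|[]].
- have Kxy := subgroupM subK Kx Ky; split=> //.
  (* Translating [H < yH] by [x] gives [H < xH < xyH]. *)
  have := lt_mul _ _ _ K1 Ky Kx lt1y; rewrite mulg1.
  by apply: lt_trans => //; apply: cosetK.
- have KVx := subgroupV subK Kx.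
  case: (lt_tri _ _ (cosetK _ K1) (cosetK _ Kx)) => [[lt1x _ _]|[_ eq1x _]|].
  + by left.
  + by case: nHx; move/left_coset_eq: eq1x => /(_ subH); rewrite invg1 mul1g.
  + move=> [_ _ /(lt_mul _ _ _ Kx K1 KVx)]; rewrite mulVg mulg1.
    by right.
Qed.

Lemma cone_left_relatively_convex P :
  positive_cone K H P -> left_relatively_convex K H.
Proof.
move=> coneP; have [PKH PM Ptot] := coneP.
(* This asks for some representatives; by [ltE] any others do, as [P] absorbs factors from [H] on
   both sides. *)
pose lt A B := exists a b : G,
  [/\ A = left_coset H a, B = left_coset H b & P (a^-1 * b)].
have ltE a b : lt (left_coset H a) (left_coset H b) <-> P (a^-1 * b).
  split=> [[c [d [/(left_coset_eq subH) Hac /esym/(left_coset_eq subH) Hdb]]]|];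
    last by exists a, b.
  move=> /(positive_coneMl coneP Hac) /(positive_coneMr coneP Hdb).
  by rewrite -!mulgA !mulVKg.
have Pasym a b : P (a^-1 * b) -> ~ P (b^-1 * a).
  move=> Pab /(PM _ _ Pab)/PKH[_]; rewrite -mulgA mulVKg mulVg.
  by case; apply: subgroup1.
have neqE a b : P (a^-1 * b) -> left_coset H a <> left_coset H b.
  by move=> /PKH[_ nHab] /(left_coset_eq subH).
exists lt; split; [split|].
- move=> _ _ _ [a _ <-] [b _ <-] [c _ <-] /ltE Pab /ltE Pbc; apply/ltE.
  by have := PM _ _ Pab Pbc; rewrite -mulgA mulVKg.
- move=> _ _ [a Ka <-] [b Kb <-]; have [Hab|nHab] := pselect (H (a^-1 * b)).
    have eq_ab := (left_coset_eq subH a b).2 Hab.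
    by constructor 2; split=> // /ltE /neqE; rewrite eq_ab.
  have := Ptot _ (subgroupM subK (subgroupV subK Ka) Kb) nHab.
  rewrite invgM invgK => -[Pab|Pba].
    constructor 1; split; [exact/ltE | exact: neqE | by move/ltE; apply: Pasym].
  constructor 3; split; [by move/ltE; apply: Pasym | | exact/ltE].
  exact/nesym/neqE.
- by move=> a b k _ _ _ /ltE Pab; apply/ltE; rewrite invgM -mulgA mulKg.
Qed.

End Cones.

(** The list may meet [G0], because the final gluing runs over all lists in [G]. *)
Lemma finite_semigroup (G : groupType) (G0 : set G)
  (hX : forall X : set G, X !=set0 -> finite_set X -> X `<=` ~` G0 ->
    exists H : set G,
      [/\ is_subgroup H,
          H `<` generated X,
          left_relatively_convex (generated X) H &
          generated X `&` G0 `<=` H]) (s : seq G) :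
  exists S : set G,
    [/\ forall x y, S x -> S y -> S (x * y),
        forall x, S x -> ~ G0 x &
        forall x, x \in s -> ~ G0 x -> S x \/ S x^-1].
Proof.
have [n] := ubnP (size s); elim: n s => // n IHn s /ltnSE le_sn.
pose X : set G := [set x | x \in s /\ ~ G0 x].
have [X0|/set0P X_n0] := eqVneq X set0.
  exists set0; split=> // x xs nG0x.
  by have : X x by []; rewrite X0.
have finX : finite_set X.
  by apply: sub_finite_set (finite_seq s) => x [].
have [|H [subH [HK /existsNP[z /not_implyP[gz nHz]]] cvxH G0H]] := hX X X_n0 finX.
  by move=> x [].
set K := generated X in HK gz cvxH G0H.
have subK : is_subgroup K by apply: generated_subgroup.
have XK : X `<=` K by apply: sub_gen_smallest.
(* If [H] contained [X], it would contain [generated X] and not be proper. This [y] makes the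
   sublist of entries in [H] strictly shorter than [s]. *)
have [y [ys nG0y] nHy] : exists2 y, X y & ~ H y.
  apply: contrapT => /forall2NP XH; apply: nHz.
  apply: (gz H); split=> // x Xx.
  by apply: contrapT => nHx; case: (XH x).
have [P coneP] := left_relatively_convex_cone subK subH cvxH.
have [PKH PM Ptot] := coneP.
have [|S [SM SG0 Stot]] := IHn [seq x <- s | x \in H].
  apply: leq_trans le_sn; rewrite size_filter ltn_neqAle count_size andbT.
  rewrite -all_count; apply/negP => /allP/(_ y ys) /set_mem.
  exact: nHy.
(* Mixed products fall in [P] by absorption, and [P] misses [G0] because [K] meets [G0] only inside
   [H]. *)
exists ((S `&` H) `|` P); split.
- move=> x1 x2 [[S1 H1]|P1] [[S2 H2]|P2].
  + by left; split; [apply: SM | apply: subgroupM].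
  + by right; apply: (positive_coneMl subK subH HK coneP).
  + by right; apply: (positive_coneMr subK subH HK coneP).
  + by right; apply: PM.
- move=> x [[Sx _]|Px] G0x; first exact: SG0 G0x.
  by have [Kx] := PKH _ Px; apply; apply: G0H.
- move=> x xs nG0x; have [Hx|nHx] := pselect (H x).
    case: (Stot x) => // [|Sx|SVx]; first by rewrite mem_filter xs andbT inE.
      by left; left.
    by right; left; split=> //; apply: subgroupV.
  by case: (Ptot x (XK _ (conj xs nG0x)) nHx) => ?; [left|right]; right.
Qed.

Theorem theorem5 (G : groupType) (G0 : set G) (hG0 : is_subgroup G0)
  (hX : forall X : set G, X !=set0 -> finite_set X -> X `<=` ~` G0 ->
    exists H : set G,
      [/\ is_subgroup H,
          H `<` generated X,
          left_relatively_convex (generated X) H &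
          generated X `&` G0 `<=` H]) :
  left_relatively_convex [set: G] G0.
Proof.
have [S HS] := choice (finite_semigroup hX).
(* An ultrafilter finer than [F] makes almost every list contain any given element. *)
pose F := filter_from [set: seq G] (fun s => [set t : seq G | {subset s <= t}]).
have properF : ProperFilter F.
  apply: filter_from_proper => [|s _]; last by exists s => x.
  apply: filter_from_filter => [|s t _ _]; first by exists [::].
  by exists (s ++ t) => // u sub_u;
    split=> x xst; apply: sub_u; rewrite mem_cat xst ?orbT.
have [U [ultraU FU]] := ultraFilterLemma properF.
have properU := @ultra_proper _ _ ultraU.
(* The limit semigroup: those [x] lying in [S s] for almost every [s]. *)
apply: (@cone_left_relatively_convex _ _ _ _ hG0 _ [set x | U [set s | S s x]]).
- by split=> [|x y]; rewrite !inE.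
- by [].
- split=> [x Ux|x y Ux Uy|x _ nG0x].
  + split=> // G0x; apply: (@filter_not_empty _ U).
    apply: filterS Ux => s Sx.
    by have [_ SG0 _] := HS s; apply: SG0 Sx G0x.
  + apply: filterS2 Ux Uy => s Sx Sy.
    by have [SM _ _] := HS s; apply: SM.
  (* If [x] is almost never in [S s], then [x^-1] is in [S s] for almost every [s], namely whenever
     moreover [x] is listed in [s]. *)
  + have [Ux|Ux] := in_ultra_setVsetC [set s | S s x] ultraU; first by left.
    right; have Uxs : U [set s | x \in s].
      by apply: FU; exists [:: x] => // t; apply; rewrite inE.
    apply: filterS2 Ux Uxs => s nSx xs.
    by have [_ _ /(_ x xs nG0x)[]] := HS s.
Qed.
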